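(* Let $(O,\perp)$ be an orthoset. Then $(O,\perp)$ is compatible if and only if $L(O,\perp)$ is a Boolean algebra.
   Context: An orthoset $(O,\perp)$ is a set $O$ with an irreflexive symmetric binary relation $\perp$. For $X\subseteq O$, $X^\perp=\{y\in O\mid y\perp x \text{ for all } x\in X\}$, and $x^\perp=\{x\}^\perp$. A subset $X$ is orthoclosed if $X=X^{\perp\perp}$. $L(O,\perp)$ denotes the complete ortholattice of all orthoclosed subsets of $O$ ordered by inclusion, with meet given by intersection, join $X\vee Y=(X\cup Y)^{\perp\perp}$, and orthocomplement $X\mapsto X^\perp$. The orthoset is called compatible if for all $x,y\in O$ with $x\not\perp y$ there exists $z\in O$ such that $x^\perp\cup y^\perp\subseteq z^\perp$. A Boolean algebra is an ortholattice satisfying the distributive law. *)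

(* Defs.v *)
From HB Require Import structures.
From mathcomp Require Import all_boot all_order.
From mathcomp Require Import boolp classical_sets.

Set Implicit Arguments.
Unset Strict Implicit.
Unset Printing Implicit Defensive.

Import Order.TTheory.

Local Open Scope classical_set_scope.

HB.mixin Record isOrthoset (O : Type) := {
  perp : O -> O -> Prop;
  perp_irrefl : forall x : O, ~ perp x x;
  perp_sym : forall x y : O, perp x y -> perp y x
}.

#[short(type="orthosetType")]
HB.structure Definition Orthoset := {O of isOrthoset O}.

Definition orthocompl_set (O : orthosetType) (X : set O) : set O :=
  [set y | forall x, X x -> perp y x].

Notation "X ^⊥" := (orthocompl_set X)
  (at level 1, left associativity, format "X ^⊥") : classical_set_scope.

Definition orthoclosed (O : orthosetType) (X : set O) : Prop := X = X^⊥^⊥.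

Definition compatible (O : orthosetType) : Prop :=
  forall x y : O, ~ perp x y ->
    exists z : O, [set x]^⊥ `|` [set y]^⊥ `<=` [set z]^⊥.

HB.mixin Record TBLattice_isOrtholattice d T of Order.TBLattice d T := {
  ocompl : T -> T;
  ocomplK : involutive ocompl;
  ocompl_le : forall x y : T, (x <= y)%O -> (ocompl y <= ocompl x)%O;
  meet_ocompl : forall x : T, (x `&` ocompl x = \bot)%O;
  join_ocompl : forall x : T, (x `|` ocompl x = \top)%O
}.

#[short(type="ortholatticeType")]
HB.structure Definition Ortholattice d :=
  {T of Order.TBLattice d T & TBLattice_isOrtholattice d T}.

Definition is_boolean_algebra d (L : ortholatticeType d) : Prop :=
  forall x y z : L, (x `&` (y `|` z) = (x `&` y) `|` (x `&` z))%O.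

Section OrthocomplTheory.
Context {O : orthosetType}.
Implicit Types X Y : set O.

Lemma orthocompl_subset X Y : X `<=` Y -> Y^⊥ `<=` X^⊥.
Proof. by move=> XY y Yy x /XY /Yy. Qed.

Lemma sub_orthocomplK X : X `<=` X^⊥^⊥.
Proof. by move=> x Xx y Xy; apply: perp_sym; exact: Xy. Qed.

Lemma orthocompl3 X : X^⊥^⊥^⊥ = X^⊥.
Proof.
apply/seteqP; split; last exact: sub_orthocomplK.
exact/orthocompl_subset/sub_orthocomplK.
Qed.

Lemma orthoclosed_orthocompl X : orthoclosed X^⊥.
Proof. by rewrite /orthoclosed orthocompl3. Qed.

Lemma orthoclosed_subset X Y : orthoclosed Y -> X `<=` Y -> X^⊥^⊥ `<=` Y.
Proof. by move=> cY XY; rewrite cY; exact/orthocompl_subset/orthocompl_subset. Qed.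

Lemma orthoclosedI X Y : orthoclosed X -> orthoclosed Y -> orthoclosed (X `&` Y).
Proof.
move=> cX cY; apply/seteqP; split; first exact: sub_orthocomplK.
by move=> x XYx; split; [apply: (orthoclosed_subset cX) XYx => ? []
                        |apply: (orthoclosed_subset cY) XYx => ? []].
Qed.

Lemma orthocomplI X : X `&` X^⊥ = set0.
Proof. by apply/seteqP; split=> x // [Xx /(_ x Xx)]; exact: perp_irrefl. Qed.

Lemma orthocomplT : (@setT O)^⊥ = set0.
Proof. by rewrite -(setTI (setT^⊥)) orthocomplI. Qed.

Lemma orthocompl0 : (@set0 O)^⊥ = setT.
Proof. by apply/seteqP; split=> // x _ y []. Qed.

Lemma orthoclosed0 : orthoclosed (@set0 O).
Proof. by rewrite -orthocomplT; exact: orthoclosed_orthocompl. Qed.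

Lemma orthoclosedT : orthoclosed (@setT O).
Proof. by rewrite -orthocompl0; exact: orthoclosed_orthocompl. Qed.

End OrthocomplTheory.

(* The carrier of L(O, ⊥): the subtype of set O of all orthoclosed sets. *)
Record closed_set (O : orthosetType) := ClosedSet {
  set_of_closed :> set O;
  closed_setP : `[< orthoclosed set_of_closed >]
}.

HB.instance Definition _ (O : orthosetType) := [isSub for @set_of_closed O].
HB.instance Definition _ (O : orthosetType) :=
  [Choice of closed_set O by <:].

Section ClosedSetLattice.
Context {O : orthosetType}.
Implicit Types X Y Z : closed_set O.

Lemma closedP X : orthoclosed X.
Proof. exact/asboolP/closed_setP. Qed.

Definition mk_closed (X : set O) (cX : orthoclosed X) : closed_set O :=
  ClosedSet (asboolT cX).

Definition closed_le X Y : bool := `[< X `<=` Y >].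
Definition closed_meet X Y : closed_set O :=
  mk_closed (orthoclosedI (closedP X) (closedP Y)).
Definition closed_join X Y : closed_set O :=
  mk_closed (orthoclosed_orthocompl (X `|` Y)^⊥).
Definition closed_compl X : closed_set O :=
  mk_closed (orthoclosed_orthocompl X).
Definition closed_bot : closed_set O := mk_closed orthoclosed0.
Definition closed_top : closed_set O := mk_closed orthoclosedT.

Lemma closed_le_refl : reflexive closed_le.
Proof. by move=> X; exact/asboolP. Qed.

Lemma closed_le_anti : antisymmetric closed_le.
Proof.
by move=> X Y /andP[/asboolP XY /asboolP YX]; apply/val_inj/seteqP.
Qed.

Lemma closed_le_trans : transitive closed_le.
Proof.
move=> Y X Z /asboolP XY /asboolP YZ; apply/asboolP.
exact: subset_trans YZ.
Qed.

HB.instance Definition _ := Order.Le_isPOrder.Build (Order.Disp tt tt)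
  (closed_set O) closed_le_refl closed_le_anti closed_le_trans.

Lemma closed_meetP X Y Z : (X <= closed_meet Y Z)%O = (X <= Y)%O && (X <= Z)%O.
Proof.
apply/asboolP/andP => [XYZ|[/asboolP XY /asboolP XZ] x Xx].
  by split; apply/asboolP => x /XYZ [].
by split; [exact: XY|exact: XZ].
Qed.

Lemma closed_joinP X Y Z : (closed_join X Y <= Z)%O = (X <= Z)%O && (Y <= Z)%O.
Proof.
apply/asboolP/andP => [XYZ|[/asboolP XZ /asboolP YZ]].
  by split; apply/asboolP => x Xx; apply: XYZ; apply: sub_orthocomplK;
    [left|right].
by apply: orthoclosed_subset (closedP Z) _ => x [/XZ|/YZ].
Qed.

Lemma closed_le0 X : (closed_bot <= X)%O.
Proof. exact/asboolP. Qed.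

Lemma closed_le1 X : (X <= closed_top)%O.
Proof. exact/asboolP. Qed.

HB.instance Definition _ := Order.POrder_MeetJoin_isLattice.Build
  (Order.Disp tt tt) (closed_set O) closed_meetP closed_joinP.
HB.instance Definition _ := Order.hasBottom.Build
  (Order.Disp tt tt) (closed_set O) closed_le0.
HB.instance Definition _ := Order.hasTop.Build
  (Order.Disp tt tt) (closed_set O) closed_le1.

Lemma closed_complK : involutive closed_compl.
Proof. by move=> X; apply/val_inj; rewrite /= -closedP. Qed.

Lemma closed_compl_le X Y :
  (X <= Y)%O -> (closed_compl Y <= closed_compl X)%O.
Proof. by move=> /asboolP XY; apply/asboolP; exact: orthocompl_subset. Qed.

Lemma meet_closed_compl X : (X `&` closed_compl X = \bot)%O.
Proof. by apply/val_inj; exact: orthocomplI. Qed.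

Lemma join_closed_compl X : (X `|` closed_compl X = \top)%O.
Proof.
apply: (inv_inj closed_complK); apply/val_inj => /=.
rewrite orthocompl3 orthocomplT; apply/seteqP; split=> // x XXx.
by apply: (@perp_irrefl O x); apply: (XXx); right=> y Xy; apply: (XXx); left.
Qed.

HB.instance Definition _ := TBLattice_isOrtholattice.Build
  (Order.Disp tt tt) (closed_set O)
  closed_complK closed_compl_le meet_closed_compl join_closed_compl.

End ClosedSetLattice.

Definition orthoset_lattice (O : orthosetType) :
  ortholatticeType (Order.Disp tt tt) := closed_set O.

(* Main.v *)
Require Import Defs.
From mathcomp Require Import all_boot all_order.
From mathcomp Require Import boolp classical_sets.

Import Order.TTheory.
Local Open Scope classical_set_scope.

(** If [z] witnesses compatibility of [x] and [y], then [z] lies in every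
    orthoclosed set containing [x] or [y].  Hence two non-orthogonal points of
    orthoclosed sets [A] and [B] yield a point of [A `&` B], and distributivity
    follows by applying this twice to an alleged counterexample.  Conversely,
    distributivity at [x^⊥⊥], [y^⊥⊥] and [y^⊥] forces [x^⊥⊥ `&` y^⊥⊥] to be
    nonempty when [x] and [y] are not orthogonal, and any of its points is a
    witness. *)

Lemma orthocompl1E (O : orthosetType) (x y : O) : [set x]^⊥ y <-> perp y x.
Proof. by split=> [|yx _ ->//]; apply. Qed.

(** Through this, compatibility says that the closures of two non-orthogonal points share a
    point. *)
Lemma sub_orthocompl1P (O : orthosetType) (x z : O) :
  [set x]^⊥ `<=` [set z]^⊥ <-> [set x]^⊥^⊥ z.
Proof.
split=> [xz y /xz /orthocompl1E /perp_sym //|xz y /xz zy].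
exact/orthocompl1E/perp_sym.
Qed.

Lemma orthoclosed_sub_orthocompl1 {O : orthosetType} {A : set O} {x z : O} :
  orthoclosed A -> A x -> [set x]^⊥ `<=` [set z]^⊥ -> A z.
Proof.
move=> cA Ax /sub_orthocompl1P.
by apply: (orthoclosed_subset cA) => _ ->.
Qed.

Lemma compatible_meets {O : orthosetType} {A B : set O} {x y : O} :
  compatible O -> orthoclosed A -> orthoclosed B -> A x -> B y ->
  ~ perp x y -> exists z, (A `&` B) z.
Proof.
move=> cO cA cB Ax By /cO[z]; rewrite subUset => -[xz yz].
by exists z; split; [exact: (orthoclosed_sub_orthocompl1 cA Ax)
                    |exact: (orthoclosed_sub_orthocompl1 cB By)].
Qed.

Lemma compatible_distr (O : orthosetType) (A B C : set O) :
  compatible O -> orthoclosed A -> orthoclosed B -> orthoclosed C ->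
  A `&` (B `|` C)^⊥^⊥ `<=` ((A `&` B) `|` (A `&` C))^⊥^⊥.
Proof.
move=> cO cA cB cC x ABCx w ABACw; apply: contrapT => xw.
(* [z] lies in the left-hand side and is orthogonal to all of [A ∩ B] and [A ∩ C]. *)
have [z [[Az BCz] ABACz]] := compatible_meets cO
  (orthoclosedI cA (orthoclosed_orthocompl _)) (orthoclosed_orthocompl _)
  ABCx ABACw xw.
(* Being in the biorthogonal of [B ∪ C], [z] cannot be orthogonal to every [b] in [B ∪ C]. *)
apply: (@perp_irrefl O z); apply: BCz => b BCb; apply: contrapT => zb.
have meetD D : orthoclosed D -> D b -> exists u,
    (A `&` ((A `&` B) `|` (A `&` C))^⊥ `&` D) u.
  move=> cD Db; apply: (compatible_meets cO _ cD (conj Az ABACz) Db zb).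
  exact: orthoclosedI cA (orthoclosed_orthocompl _).
(* [u] lies in [A ∩ B] or [A ∩ C] and is orthogonal to both, hence to itself. *)
case: BCb => [/(meetD _ cB)|/(meetD _ cC)] [u [[Au Nu] Du]];
  by apply: (@perp_irrefl O u); apply: Nu; (left + right); split.
Qed.

Lemma boolean_compatible (O : orthosetType) :
  is_boolean_algebra (orthoset_lattice O) -> compatible O.
Proof.
move=> distr x y xy.
pose X : orthoset_lattice O := mk_closed (orthoclosed_orthocompl [set x]^⊥).
pose Y : orthoset_lattice O := mk_closed (orthoclosed_orthocompl [set y]^⊥).
have [[z [/sub_orthocompl1P xz /sub_orthocompl1P yz]]|XY0] :=
    pselect (exists z, ([set x]^⊥^⊥ `&` [set y]^⊥^⊥) z).
  by exists z; rewrite subUset.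
have XYbot : (X `&` Y = \bot)%O.
  by apply/val_inj/seteqP; split=> // z XYz; case: XY0; exists z.
(* Distributivity turns [X = X ∧ (Y ∨ Y^⊥)] into [X = X ∧ Y^⊥], as [X ∧ Y] is bottom. *)
have : (X <= ocompl Y)%O.
  have := distr X Y (ocompl Y).
  by rewrite join_ocompl meetx1 XYbot join0x => ->; exact: leIr.
move=> /asboolP/(_ x)/(_ (sub_orthocomplK _)) Yx.
by case: xy; apply: Yx => //; exact: sub_orthocomplK.
Qed.

Theorem theorem3p2 (O : orthosetType) :
  compatible O <-> is_boolean_algebra (orthoset_lattice O).
Proof.
split=> [cO A B C|]; last exact: boolean_compatible.
apply/le_anti/andP; split; last first.
  (* This inequality holds in every lattice. *)
  by rewrite leUx !lexI !leIl /= leIxr ?leUl // leIxr ?leUr.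
by apply/asboolP; apply: compatible_distr => //; exact: closedP.
Qed.
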